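(* For every Schubert union $U=S_U$ in $G(l,m)$, the geometrically dual Schubert union of the geometrically dual Schubert union of $U$ is $U$; i.e. $D(D(S_U))=S_U$ under the canonical identification $V^{**}=V$.
   Context: Let $F$ be a field, $1\le l<m$ integers, $V$ an $m$-dimensional $F$-vector space with basis $e_1,\dots,e_m$, and $A_i=\mathrm{Span}(e_1,\dots,e_i)$. $G(l,m)$ is the Grassmann variety of $l$-dimensional subspaces of $V$. For $\alpha=(a_1,\dots,a_l)$ with $1\le a_1<\dots<a_l\le m$, the Schubert cycle is $S_\alpha=\{W\in G(l,m):\dim(W\cap A_{a_i})\ge i\ \forall i\}$; a Schubert union is a finite (possibly empty) union of such Schubert cycles. $G(l,m)^*$ is the Grassmann variety of $l$-dimensional subspaces of $V^*$; Schubert unions in it are taken with respect to the dual flag $0=A_m^\bot\subset A_{m-1}^\bot\subset\dots\subset A_1^\bot\subset V^*$, where $L^\bot=\{h\in V^*:L\subset\ker h\}$. For $M\subset G(l,m)$ the geometric dual $D(M)\subset G(l,m)^*$ is the set of $l$-dimensional subspaces $P\subset V^*$ whose common kernel $\bigcap_{h\in P}\ker h$ intersects every $W\in M$ nontrivially; the geometric dual of a subset of $G(l,m)^*$ is defined in the same way with $V$ replaced by $V^*$. The geometric dual of a Schubert union is again a Schubert union (with respect to the dual flag). *)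

(* Defs.v *)
From HB Require Import structures.
From mathcomp Require Import all_boot all_order all_algebra.
From mathcomp Require Import boolp classical_sets.

Set Implicit Arguments.
Unset Strict Implicit.
Unset Printing Implicit Defensive.

Import GRing.Theory.

Local Open Scope ring_scope.
Local Open Scope classical_set_scope.

Section GeometricDual.
Variables (F : fieldType) (V : vectType F).
Implicit Types (W : {vspace V}) (M : set {vspace V}).

Definition grassmannian (l : nat) : set {vspace V} :=
  [set W | \dim W = l].

Definition flag (m : nat) (e : m.-tuple V) (i : nat) : {vspace V} :=
  <<take i e>>%VS.

(* The entries of an index are numbered from 1, as in 1 <= a_1 < ... < a_l <= m,
   while [tnth] counts from 0: a_(i.+1) is [tnth a i]. *)
Definition schubert_index (l m : nat) (a : l.-tuple nat) : bool :=
  sorted ltn a && all (fun k => 1 <= k <= m)%N a.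

Definition schubert_cycle (A : nat -> {vspace V}) (l : nat)
    (a : l.-tuple nat) : set {vspace V} :=
  [set W | grassmannian l W /\
           forall i : 'I_l, (i.+1 <= \dim (W :&: A (tnth a i)))%N].

Definition schubert_union (l m : nat) (A : nat -> {vspace V}) :
    set (set {vspace V}) :=
  [set U | exists2 s : seq (l.-tuple nat), all (@schubert_index l m) s
           & U = \bigcup_(a in [set` s]) schubert_cycle A a].

Definition common_kernel (P : {vspace 'Hom(V, F^o)}) : set V :=
  \bigcap_(h in [set` P]) [set` lker h].

End GeometricDual.

Definition geometric_dual (F : fieldType) (V : vectType F) (l : nat)
    (M : set {vspace V}) : set {vspace 'Hom(V, F^o)} :=
  [set P | grassmannian l P /\
           forall W, M W -> exists v : V, [/\ v != 0, v \in W & common_kernel P v]].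

Definition bidual_map (F : fieldType) (V : vectType F) :
    'Hom(V, 'Hom('Hom(V, F^o), F^o)) :=
  linfun (fun v : V => linfun (fun h : 'Hom(V, F^o) => h v)).

(* [linfun] is only meaningful on linear arguments; this is the case here. *)
Lemma bidual_mapE (F : fieldType) (V : vectType F) (v : V) (h : 'Hom(V, F^o)) :
  bidual_map V v h = h v.
Proof.
have lin1 u : linear (fun k : 'Hom(V, F^o) => k u).
  by move=> a k k'; rewrite add_lfunE scale_lfunE.
pose ev1 u : {linear 'Hom(V, F^o) -> F^o} :=
  HB.pack (fun k : 'Hom(V, F^o) => k u) (GRing.isLinear.Build _ _ _ _ _ (lin1 u)).
have ev1E u k : linfun (fun k : 'Hom(V, F^o) => k u) k = k u.
  exact: (lfunE (ev1 u) k).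
have lin2 : linear (fun u : V => linfun (fun k : 'Hom(V, F^o) => k u)).
  move=> a u u'; apply/lfunP => k.
  by rewrite add_lfunE scale_lfunE !ev1E linearP.
pose ev2 : {linear V -> 'Hom('Hom(V, F^o), F^o)} :=
  HB.pack (fun u : V => linfun (fun k : 'Hom(V, F^o) => k u))
          (GRing.isLinear.Build _ _ _ _ _ lin2).
by rewrite /bidual_map (lfunE ev2) ev1E.
Qed.

(* Main.v *)
Require Import Defs.
From HB Require Import structures.
From mathcomp Require Import all_boot all_order all_algebra.
From mathcomp Require Import boolp classical_sets.

(** Write [P^perp] for the common kernel of a space [P] of linear forms and
    [W^perp] for the space of forms that vanish on [W].  Once [V] is identified
    with its bidual, [D (D U)] consists by definition of the [l]-dimensional [W]
    such that [W^perp] meets every [P] in [D U].  When [dim W = dim P] and [W]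
    meets [P^perp], the pairing between [W] and [P] is square and degenerate, so
    [W^perp] meets [P] as well ([meets_common_kernel_dual]).  This gives the
    inclusion of [U] in [D (D U)], for any set [U] of [l]-dimensional spaces.

    For the converse, a space [W] of dimension [l] outside [U] has to be
    separated from [U] by some [P] in [D U] with [P] and [W^perp] transverse.
    Let [J] be the set of [l] indices at which the dimension of [W :&: A_k]
    jumps, and let [P] be spanned by the coordinate forms indexed by [J].
    A form [h] in [P] that vanishes on [W] is zero: if [j] in [J] were the
    first index with [h e_j <> 0], then [h] could not vanish on a vector of [W]
    that lies in [A_j] and not in [A_(j-1)] ([pivot_span_transverse]).

    On the other hand [W] is in no cycle [S_a] of [U], so some [a_i] satisfies
    [dim (W :&: A_(a_i)) < i], which means that fewer than [i] indices of [J]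
    are at most [a_i].  On [A_(a_i)] all other coordinate forms of [J] vanish,
    so [P^perp] is cut out there by fewer than [i] equations, whereas each [X]
    in [S_a] meets [A_(a_i)] in dimension at least [i].  Therefore [X] meets
    [P^perp] ([pivot_span_meets_cycle]), and [P] is in [D U]. *)

Set Implicit Arguments.
Unset Strict Implicit.
Unset Printing Implicit Defensive.

Import GRing.Theory.

Local Open Scope ring_scope.
Local Open Scope classical_set_scope.

(** * Linear forms and common kernels *)

Lemma dim_hom_field (F : fieldType) (V : vectType F) :
  \dim {: 'Hom(V, F^o)} = \dim {: V}.
Proof. by rewrite !dimvf /dim /= muln1. Qed.

Lemma exists_common_zero (F : fieldType) (V : vectType F)
    (fs : seq 'Hom(V, F^o)) (W : {vspace V}) :
  (size fs < \dim W)%N ->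
  exists v, [/\ v != 0, v \in W & forall f, f \in fs -> f v = 0].
Proof.
elim: fs W => [|f fs IH] W /= ltW.
  exists (vpick W); split; [|exact: memv_pick|by []].
  by rewrite vpick0 -dimv_eq0 -lt0n.
have [|v [v0]] := IH (W :&: lker f)%VS.
  have leimg : (\dim (f @: W) <= 1)%N.
    by rewrite (leq_trans (dimvS (subvf _))) // dimvf.
  rewrite -ltnS (leq_trans ltW) // -(limg_ker_dim f W).
  by rewrite -addn1 leq_add2l.
rewrite memv_cap memv_ker => /andP[vW /eqP fv] fsv; exists v; split=> // g.
by rewrite inE => /predU1P[->|/fsv].
Qed.

Lemma common_kernelP (F : fieldType) (V : vectType F)
    (P : {vspace 'Hom(V, F^o)}) (v : V) :
  common_kernel P v <-> forall h, h \in P -> h v = 0.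
Proof.
split=> [Pv h hP | Pv h /= hP].
  by apply/eqP; rewrite -memv_ker; apply: Pv.
by rewrite memv_ker Pv.
Qed.

Lemma common_kernel_spanP (F : fieldType) (V : vectType F)
    (X : seq 'Hom(V, F^o)) (v : V) :
  common_kernel <<X>>%VS v <-> forall h, h \in X -> h v = 0.
Proof.
rewrite common_kernelP; split=> [Xv h hX | Xv h hX].
  by apply: Xv; apply: memv_span.
(* The forms that vanish at [v] are the kernel of evaluation at [v]. *)
have /subvP/(_ h hX) : (<<X>> <= lker (bidual_map V v))%VS.
  by apply/span_subvP => k /Xv kv; rewrite memv_ker bidual_mapE kv.
by rewrite memv_ker bidual_mapE => /eqP.
Qed.

(** A common zero [v] of [P] in [W] leaves only [\dim W - 1] conditions for
    a form in [P] to vanish on [W], namely on a basis of a complement of [v]. *)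
Lemma meets_common_kernel_dual (F : fieldType) (V : vectType F)
    (W : {vspace V}) (P : {vspace 'Hom(V, F^o)}) (v : V) :
    (\dim W <= \dim P)%N -> v != 0 -> v \in W -> common_kernel P v ->
  exists h, [/\ h != 0, h \in P & forall w, w \in W -> h w = 0].
Proof.
move=> leWP v0 vW /common_kernelP Pv.
pose W' := (W :\: <[v]>)%VS.
have svW : (<[v]> <= W)%VS by rewrite -memvE.
have [|h [h0 hP hW']] :=
    @exists_common_zero _ _ [seq bidual_map V w | w <- vbasis W'] P.
  rewrite size_map size_tuple (leq_trans _ leWP) //.
  by rewrite -(dimv_cap_compl W <[v]>) (capv_idPr svW) dim_vline v0.
exists h; split=> // w.
have /subvP sW : (W <= lker h)%VS.
  rewrite -(addv_diff_cap W <[v]>) (capv_idPr svW) subv_add.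
  rewrite -memvE memv_ker (Pv h hP) eqxx andbT.
  rewrite -/W' -(span_basis (vbasisP W')); apply/span_subvP => u uW'.
  by rewrite memv_ker -bidual_mapE hW' ?map_f.
by move/sW; rewrite memv_ker => /eqP.
Qed.

(** * Coordinate forms of the flag *)

Section DualBasis.
Variables (F : fieldType) (V : vectType F) (m : nat) (e : m.-tuple V).
Hypothesis he : basis_of fullv e.

(** [coord e i] as a vector of the dual space, so that it can be used in spans. *)
Definition coord_form (i : 'I_m) : 'Hom(V, F^o) :=
  linfun (coord e i : V -> F^o).

Lemma coord_formE i v : coord_form i v = coord e i v.
Proof.
have lin : linear (coord e i : V -> F^o) by move=> a u w; rewrite linearP.
pose c : {linear V -> F^o} :=
  HB.pack (coord e i : V -> F^o) (GRing.isLinear.Build _ _ _ _ _ lin).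
exact: (lfunE c v).
Qed.

Lemma coord_form_basis (i j : 'I_m) : coord_form i e`_j = (i == j)%:R.
Proof. by rewrite coord_formE coord_free ?(basis_free he) // eq_sym. Qed.

Lemma coord_form_sum v : v = \sum_i coord_form i v *: e`_i.
Proof.
rewrite {1}(coord_basis he (memvf v)).
by apply: eq_bigr => i _; rewrite coord_formE.
Qed.

Lemma lfun_coord_sum (h : 'Hom(V, F^o)) v :
  h v = \sum_i coord_form i v * h e`_i.
Proof.
rewrite {1}(coord_form_sum v) linear_sum.
by apply: eq_bigr => i _; rewrite linearZ.
Qed.

Lemma mem_flagP k v :
  reflect (forall i : 'I_m, (k <= i)%N -> coord_form i v = 0) (v \in flag e k).
Proof.
apply: (iffP idP) => [vk i ki | vk].
  have /subvP/(_ v vk) : (flag e k <= lker (coord_form i))%VS.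
    apply/span_subvP => x /(nthP 0)[j]; rewrite size_take size_tuple => ltj <-.
    have [jk jm] : (j < k)%N /\ (j < m)%N.
      by move: ltj; case: (ltnP k m) => km jl; split=> //;
         [exact: ltn_trans km | exact: leq_trans km].
    rewrite nth_take // memv_ker (coord_form_basis i (Ordinal jm)).
    by rewrite -val_eqE gtn_eqF // (leq_trans jk).
  by rewrite memv_ker => /eqP.
rewrite (coord_form_sum v); apply: memv_suml => i _.
have [ki|ik] := leqP k i; first by rewrite vk // scale0r mem0v.
apply/memvZ/memv_span; rewrite -(nth_take 0 ik) mem_nth //.
by rewrite size_take size_tuple; case: ifP.
Qed.

Lemma flag0 : flag e 0 = 0%VS.
Proof. by rewrite /flag take0 span_nil. Qed.

Lemma flag_full : flag e m = fullv.
Proof. by rewrite /flag take_oversize ?size_tuple // (span_basis he). Qed.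

Lemma flagS (i : 'I_m) : (flag e i.+1 :&: lker (coord_form i) = flag e i)%VS.
Proof.
apply/vspaceP => v; rewrite memv_cap memv_ker.
apply/andP/mem_flagP => [[/mem_flagP vi /eqP iv] j | vi].
  by rewrite leq_eqVlt => /predU1P[/val_inj <- // | /vi].
by split; [apply/mem_flagP => j /ltnW/vi | rewrite vi].
Qed.

(** * Pivots of a subspace *)

(** The pivot columns of the reduced echelon form of [W], numbered from 0, when
    the leading entry of a vector is its last nonzero coordinate. *)
Definition pivots (W : {vspace V}) : {set 'I_m} :=
  [set i : 'I_m | ~~ (W :&: flag e i.+1 <= lker (coord_form i))%VS].

(** A nonzero linear form has a one-dimensional image, so the dimension of
    [W :&: flag e k] grows by at most one at each step, exactly at pivots. *)
Lemma dim_cap_flagS W (i : 'I_m) :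
  \dim (W :&: flag e i.+1) = (\dim (W :&: flag e i) + (i \in pivots W))%N.
Proof.
rewrite -(limg_ker_dim (coord_form i) (W :&: flag e i.+1)) -capvA flagS.
congr (_ + _)%N; rewrite inE lkerE -dimv_eq0.
have := dimvS (subvf (coord_form i @: (W :&: flag e i.+1))%VS).
by rewrite dimvf; case: (\dim _) => [|[|?]].
Qed.

Lemma card_pivots_lt W k : (k <= m)%N ->
  #|[set i in pivots W | (i < k)%N]| = \dim (W :&: flag e k).
Proof.
elim: k => [_ | k IH km].
  rewrite flag0 capv0 dimv0; apply: eq_card0 => i.
  by rewrite !inE ltn0 andbF.
pose i0 := Ordinal km.
rewrite (dim_cap_flagS W i0) -(IH (ltnW km)).
rewrite (cardsD1 i0) addnC !inE /= ltnSn andbT; congr (_ + _)%N.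
apply: eq_card => j; rewrite !inE -val_eqE /= ltnS [(j <= k)%N]leq_eqVlt.
by case: eqP => //= ->; rewrite ltnn andbF.
Qed.

Lemma card_pivots W : #|pivots W| = \dim W.
Proof.
rewrite -[in RHS](capvf W) -flag_full -card_pivots_lt //.
by apply: eq_card => i; rewrite !inE ltn_ord andbT.
Qed.

Definition pivot_forms W : #|pivots W|.-tuple 'Hom(V, F^o) :=
  [tuple coord_form (enum_val i) | i < #|pivots W|].

Definition pivot_span W : {vspace 'Hom(V, F^o)} := <<pivot_forms W>>%VS.

Lemma mem_pivot_forms W h :
  h \in pivot_forms W -> exists2 j, j \in pivots W & h = coord_form j.
Proof.
case/tnthP => i ->; rewrite tnth_mktuple.
by exists (enum_val i) => //; apply: enum_valP.
Qed.

Lemma pivot_forms_free W : free (pivot_forms W).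
Proof.
apply/freeP => k k0 i.
move/lfunP/(_ e`_(enum_val i)): k0; rewrite sum_lfunE zero_lfunE => <-.
rewrite (bigD1 i) //= big1 ?addr0 => [|j ji]; rewrite scale_lfunE
  -(tnth_nth 0 (pivot_forms W)) tnth_mktuple coord_form_basis (inj_eq enum_val_inj).
  by rewrite eqxx /= [RHS]mulr1.
by rewrite (negPf ji) scaler0.
Qed.

Lemma dim_pivot_span W : \dim (pivot_span W) = \dim W.
Proof. by rewrite (eqnP (pivot_forms_free W)) size_tuple card_pivots. Qed.

(** The matrix that pairs the coordinate forms of the pivots with an echelon
    basis of [W] is triangular with nonzero diagonal; the induction on [i] is
    the forward substitution that solves the resulting system for [h]. *)
Lemma pivot_span_transverse W h :
  h \in pivot_span W -> (forall w, w \in W -> h w = 0) -> h = 0.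
Proof.
move=> hP hW; apply/lfunP => v; rewrite zero_lfunE lfun_coord_sum big1 // => i _.
suff -> : h e`_i = 0 by rewrite mulr0.
have [n] := ubnP (i : nat); elim: n i => // n IH i; rewrite ltnS => lei.
have [iJ | iJ] := boolP (i \in pivots W); last first.
  suff /common_kernelP/(_ h hP) : common_kernel (pivot_span W) e`_i by [].
  apply/common_kernel_spanP => g /mem_pivot_forms[j jJ ->].
  by rewrite coord_form_basis; case: eqP jJ iJ => // -> ->.
move: iJ; rewrite inE => /subvPn[w].
rewrite memv_cap memv_ker => /andP[/hW + /mem_flagP wi] wi0.
(* Coordinates of [w] after [i] vanish, values of [h] before [i] do. *)
rewrite lfun_coord_sum (bigD1 i) //= big1 => [|j ji].
  by rewrite addr0 => /eqP; rewrite mulf_eq0 (negPf wi0) => /eqP.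
have [ltji | ltij | eqji] := ltngtP j i.
- by rewrite IH ?mulr0 // (leq_trans ltji).
- by rewrite wi ?mul0r.
by rewrite (val_inj eqji) eqxx in ji.
Qed.

(** On [flag e k] the only pivot forms that do not vanish are those of index
    below [k], and there are [\dim (W :&: flag e k)] of them. *)
Lemma pivot_span_meets_cycle W X k : (k <= m)%N ->
    (\dim (W :&: flag e k) < \dim (X :&: flag e k))%N ->
  exists v, [/\ v != 0, v \in X & common_kernel (pivot_span W) v].
Proof.
move=> km; rewrite -card_pivots_lt // => ltWX.
have [|v [v0]] := @exists_common_zero _ _
    [seq coord_form i | i in [set i in pivots W | (i < k)%N]] (X :&: flag e k)%VS.
  by rewrite size_map -cardE.
rewrite memv_cap => /andP[vX /mem_flagP vk] Jv; exists v; split=> //.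
apply/common_kernel_spanP => _ /mem_pivot_forms[j jJ ->].
have [/vk // | jk] := leqP k j.
by apply/Jv/map_f; rewrite mem_enum inE jJ.
Qed.

(** * The bidual *)

(** The coordinate forms separate the points of [V]. *)
Lemma lker_bidual_map : lker (bidual_map V) = 0%VS.
Proof.
apply/eqP/lker0P => u v uv; rewrite (coord_form_sum u) (coord_form_sum v).
by apply: eq_bigr => i _; rewrite -(bidual_mapE u) -(bidual_mapE v) uv.
Qed.

Lemma dim_bidual_map W : \dim (bidual_map V @: W) = \dim W.
Proof. by apply: limg_dim_eq; rewrite lker_bidual_map capv0. Qed.

Lemma limg_bidual_map : limg (bidual_map V) = fullv.
Proof.
by apply/eqP; rewrite eqEdim subvf dim_bidual_map !dim_hom_field leqnn.
Qed.

End DualBasis.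

Lemma common_kernel_bidual (F : fieldType) (V : vectType F) (W : {vspace V}) h :
  common_kernel (bidual_map V @: W)%VS h <-> forall w, w \in W -> h w = 0.
Proof.
rewrite common_kernelP; split=> [Wh w wW | Wh _ /memv_imgP[w wW ->]].
  by rewrite -bidual_mapE; apply/Wh/memv_img.
by rewrite bidual_mapE Wh.
Qed.

Theorem corollary2p17 (F : fieldType) (l m : nat) (hlm : (1 <= l < m)%N)
    (V : vectType F) (e : m.-tuple V) (he : basis_of fullv e)
    (U : set {vspace V}) (hU : schubert_union l m (flag e) U) :
  geometric_dual l (geometric_dual l U) =
  [set (bidual_map V @: W)%VS | W in U].
Proof.
case: hU => s /allP s_index defU.
apply/seteqP; split=> [Q [dimQ DQ] | _ [W UW <-]]; last first.
  have dimW : \dim W = l by move: UW; rewrite defU => -[a _ []].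
  split=> [|P [dimP /(_ W UW)[v [v0 vW Pv]]]].
    exact: etrans (dim_bidual_map he W) dimW.
  have [|h [h0 hP hW]] := meets_common_kernel_dual _ v0 vW Pv.
    by rewrite dimW dimP.
  by exists h; split=> //; apply/common_kernel_bidual.
(* [W] is [Q] seen in [V]; outside [U], it is separated from [U] by the span of
   its pivot forms. *)
pose W := (bidual_map V @^-1: Q)%VS.
have defQ : (bidual_map V @: W)%VS = Q.
  by apply: lpreimK; rewrite (limg_bidual_map he) subvf.
have dimW : \dim W = l by rewrite -(dim_bidual_map he) defQ.
exists W => //; apply: contrapT => nUW.
have [|h [h0 hP Qh]] := DQ (pivot_span e W).
  split=> [|X]; first exact: etrans (dim_pivot_span he W) dimW.
  rewrite {1}defU => -[a sa [dimX Xa]].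
  have [i ltWi] : exists i : 'I_l, (\dim (W :&: flag e (tnth a i)) < i.+1)%N.
    apply: contrapT => nlt; apply: nUW; rewrite defU; exists a => //; split=> // i.
    by rewrite leqNgt; apply/negP => lti; apply: nlt; exists i.
  have le_m : (tnth a i <= m)%N.
    have /andP[_ /allP/(_ _ (mem_tnth i a))] := s_index a sa.
    by case/andP.
  by apply: (pivot_span_meets_cycle he le_m); apply: leq_trans ltWi (Xa i).
move: h0; rewrite (pivot_span_transverse he hP) ?eqxx //.
by apply/common_kernel_bidual; rewrite defQ.
Qed.
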